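(* Let $(X,d)$ be a compact metric space and $T:X\to X$ any map. If $I$ is a computable interpretation function on $X$ and $J$ is any interpretation function on $X$ (not necessarily computable), then $\mathcal E^I(x)\ge\mathcal E^J(x)$ for every $x\in X$.
   Context: $\Sigma=\{0,1\}^*$, $|s|$ the length of $s$; a universal Turing machine $\mathcal U$ is fixed and viewed as a partial recursive function $\Sigma\to\Sigma$. An interpretation function is $I:\Sigma\to X$ with dense image; it is computable if there is a total recursive $D:\Sigma\times\Sigma\times\mathbb N\to\mathbb Q$ with $|d(I(s_1),I(s_2))-D(s_1,s_2,n)|\le2^{-n}$ for all $s_1,s_2,n$. Fix a total recursive surjection $\mathcal Q:\Sigma\to\Sigma^*$ onto finite sequences of strings. For an interpretation $I$ and program $p$ with $\mathcal U(p)$ defined, $U(p)=I(\mathcal Q(\mathcal U(p)))\in X^*$, with $i$-th entry $U_i(p)$ (from $0$). $\mathcal E^I(x,n,\epsilon)=\min\{|p|: U(p)\in X^{n+1},\ \max_{0\le i\le n}d(U_i(p),T^i(x))<\epsilon\}$. Hyperreals: $\mathbb R^*$ an ordered field containing $\mathbb R$ with a surjective ring homomorphism $J:\mathbb R^{\mathbb N}\to\mathbb R^*$ such that if $a\in\mathbb R$ and $\exists k\ge1$ with $\phi_{kn}\ge a$ for all $n\ge1$ then $J(\phi)\ge a$; for nonzero $a,b$, $a\simeq b$ iff $a/b,b/a$ are bounded; $[a]$ the class; $[a]\le[b]$ iff for all $x\in[a],y\in[b]$, $x\simeq y$ or $x<y$. $\mathcal R$ is the totally ordered set of $\approx$-classes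 of monotone sequences in $\mathbb R^*/{\simeq}$ ($(a_i)<(b_j)$ iff $\exists M$ with $a_n<b_m$ for all $n,m>M$; $\approx$ iff neither $<$), containing $\mathbb R^*/{\simeq}$ as constant sequences, in which monotone sequences have sups and infs. $\mathcal E^I(x,\epsilon)=[J((\mathcal E^I(x,n,\epsilon))_n)]$ and $\mathcal E^I(x)=\sup_{\epsilon>0}\mathcal E^I(x,\epsilon)\in\mathcal R$. *)

(* Defs.v *)
From HB Require Import structures.
From mathcomp Require Import all_boot all_order all_algebra.
From mathcomp Require Import reals Rstruct.
From Stdlib Require Import ClassicalEpsilon.
Set Implicit Arguments. Unset Strict Implicit. Unset Printing Implicit Defensive.
Import Order.TTheory GRing.Theory Num.Theory.
Local Open Scope ring_scope.

Notation RR := Rdefinitions.R.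

(* Computation model: register (Minsky) machines on nat.               *)
Inductive instr := Inc of nat | Dec of nat & nat.
Definition mstate := (nat * (nat -> nat))%type.

Definition upd (f : nat -> nat) (r v : nat) : nat -> nat :=
  fun i => if i == r then v else f i.

Definition mstep (prog : seq instr) (st : mstate) : mstate :=
  let: (pc, regs) := st in
  if (pc < size prog)%N then
    match nth (Inc 0) prog pc with
    | Inc r => (pc.+1, upd regs r (regs r).+1)
    | Dec r j => if regs r == 0%N then (j, regs)
                 else (pc.+1, upd regs r (regs r).-1)
    end
  else st.

Definition runs (prog : seq instr) (x y : nat) : Prop :=
  exists k, let: (pc, regs) := iter k (mstep prog) (0%N, upd (fun _ => 0%N) 0 x) in
            (size prog <= pc)%N /\ regs 0%N = y.

(* bijective base-2 numeration: Sigma = {0,1}^* <-> nat *)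
Definition scode (s : seq bool) : nat :=
  foldl (fun n (b : bool) => (2 * n + 1 + b)%N) 0%N s.
(* Cantor pairing nat * nat <-> nat *)
Definition cpair (a b : nat) : nat := (((a + b) * (a + b).+1)./2 + b)%N.
Fixpoint lcode (l : seq (seq bool)) : nat :=
  match l with [::] => 0%N | s :: l' => (cpair (scode s) (lcode l')).+1 end.
Definition code_val (y : nat) (r : RR) : Prop :=
  exists a b c, y = cpair a (cpair b c) /\
    r = (-1) ^+ a * (b%:R / (c.+1)%:R).

(* U : Sigma -> Sigma partial (None = undefined), partial recursive and
   universal: every partial recursive f : Sigma -> Sigma is simulated by
   U after some fixed prefix (the code of a machine for f). *)
Definition universal_machine (U : seq bool -> option (seq bool)) : Prop :=
  (exists M, forall p y, U p = Some y <-> runs M (scode p) (scode y)) /\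
  (forall M, exists c : seq bool, forall p y,
      U (c ++ p) = Some y <-> runs M (scode p) (scode y)).

Definition total_recursive_surjection (Q : seq bool -> seq (seq bool)) : Prop :=
  (exists M, forall s, runs M (scode s) (lcode (Q s))) /\
  (forall l, exists s, Q s = l).

Definition is_metric (X : Type) (d : X -> X -> RR) : Prop :=
  (forall x y, d x y = 0 <-> x = y) /\
  (forall x y, d x y = d y x) /\
  (forall x y z, d x z <= d x y + d y z).

Definition d_open (X : Type) (d : X -> X -> RR) (A : X -> Prop) : Prop :=
  forall x, A x -> exists r : RR, 0 < r /\ forall y, d x y < r -> A y.

Definition compact_metric (X : Type) (d : X -> X -> RR) : Prop :=
  is_metric d /\
  forall (Ix : Type) (O : Ix -> X -> Prop),
    (forall i, d_open d (O i)) -> (forall x, exists i, O i x) ->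
    exists l : seq Ix, forall x, exists i, List.In i l /\ O i x.

Definition interpretation (X : Type) (d : X -> X -> RR)
  (I : seq bool -> X) : Prop :=
  forall x (e : RR), 0 < e -> exists s, d (I s) x < e.

Definition computable_interpretation (X : Type) (d : X -> X -> RR)
  (I : seq bool -> X) : Prop :=
  interpretation d I /\
  exists M, forall s1 s2 n, exists y r,
    runs M (cpair (scode s1) (cpair (scode s2) n)) y /\ code_val y r /\
    `|d (I s1) (I s2) - r| <= (2%:R : RR) ^- n.

Definition natmin (P : nat -> Prop) : nat :=
  epsilon (inhabits 0%N) (fun k => P k /\ forall j, P j -> (k <= j)%N).

Definition Eset (X : Type) (d : X -> X -> RR) (T : X -> X)
  (U : seq bool -> option (seq bool)) (Q : seq bool -> seq (seq bool))
  (I : seq bool -> X) (x : X) (n : nat) (e : RR) (k : nat) : Prop :=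
  exists p out, U p = Some out /\ size p = k /\ size (Q out) = n.+1 /\
    forall i, (i <= n)%N -> d (I (nth [::] (Q out) i)) (iter i T x) < e.

Definition Ecomp X d T U Q I x n e : nat := natmin (@Eset X d T U Q I x n e).

Definition hyperreals (F : realFieldType) (iota : {rmorphism RR -> F})
  (Jh : (nat -> RR) -> F) : Prop :=
  (forall a b : RR, (iota a <= iota b) = (a <= b)) /\
  (forall f g, Jh (fun n => f n + g n) = Jh f + Jh g) /\
  (forall f g, Jh (fun n => f n * g n) = Jh f * Jh g) /\
  Jh (fun _ => 1) = 1 /\
  (forall z : F, exists f, Jh f = z) /\
  (forall (a : RR) f, (exists k, (0 < k)%N /\ forall n, (0 < n)%N -> a <= f (k * n)%N) ->
     iota a <= Jh f).

Section Classes.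
Variables (F : realFieldType) (iota : {rmorphism RR -> F}).

Definition hbounded (z : F) : Prop := exists r : RR, `|z| <= iota r.
Definition simeq (a b : F) : Prop := hbounded (a / b) /\ hbounded (b / a).
(* [a] <= [b] on classes of positive hyperreals *)
Definition cle (a b : F) : Prop :=
  forall x y, 0 < x -> 0 < y -> simeq x a -> simeq y b -> simeq x y \/ x < y.
Definition clt (a b : F) : Prop := cle a b /\ ~ simeq a b.

(* the ordered set \mathcal R: monotone sequences of classes, modulo ~~ *)
Definition mono_seq (u : nat -> F) : Prop :=
  (forall n, 0 < u n) /\
  ((forall n m, (n <= m)%N -> cle (u n) (u m)) \/
   (forall n m, (n <= m)%N -> cle (u m) (u n))).
Definition rlt (u v : nat -> F) : Prop :=
  exists M, forall n m, (M < n)%N -> (M < m)%N -> clt (u n) (v m).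
Definition rapprox (u v : nat -> F) : Prop := ~ rlt u v /\ ~ rlt v u.
Definition rle (u v : nat -> F) : Prop := rlt u v \/ rapprox u v.

Definition is_sup_eps (c : RR -> F) (s : nat -> F) : Prop :=
  mono_seq s /\
  (forall e : RR, 0 < e -> rle (fun _ => c e) s) /\
  (forall u, mono_seq u -> (forall e : RR, 0 < e -> rle (fun _ => c e) u) -> rle s u).

Definition sup_ge (c c' : RR -> F) : Prop :=
  (exists s, is_sup_eps c s) /\ (exists s, is_sup_eps c' s) /\
  forall s s', is_sup_eps c s -> is_sup_eps c' s' -> rle s' s.
End Classes.

(* E^I(x, eps) as a representative hyperreal J((E^I(x,n,eps))_n) *)
Definition Eeps (F : realFieldType) (Jh : (nat -> RR) -> F)
  X d T U Q (I : seq bool -> X) (x : X) (e : RR) : F :=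
  Jh (fun n => (@Ecomp X d T U Q I x n e)%:R).

(* Main.v *)
Require Import Defs.
From HB Require Import structures.
From mathcomp Require Import all_boot all_order all_algebra zify lra.
From mathcomp Require Import reals Rstruct.
From Stdlib Require Import FunctionalExtensionality ClassicalEpsilon Classical.
Import Order.TTheory GRing.Theory Num.Theory.

(* Given [e > 0], compactness and density give finitely many pairs [(s_i, t_i)]
   with [I s_i] close to [J t_i] and the [J t_i] forming a net of [X].  As [I] is
   computable, the map sending [s] to the first [t_i] whose [s_i] passes an
   approximate test of closeness to [s] is computable, so a fixed prefix turns
   every program tracing an orbit to precision [2 ^- n] through [I] into one
   tracing it to precision [e] through [J].  Hence
   [E^J(x,n,e) <= E^I(x,n,delta) + c]; since [E^I(x,n,delta)] tends to infinity
   with [n], the constant [c] is absorbed and the class of [E^J(x,e)] is at most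
   that of [E^I(x,delta)].  The supremum over [e] is represented by the sequence
   [e = 1/(n+1)]. *)

Local Open Scope nat_scope.

(** * Combining register machines *)

(** Unlike [runs], all registers are tracked at the start and at the halt, so that executions can be
    chained. *)
Definition exec (P : seq instr) (st st' : nat -> nat) : Prop :=
  exists k pc, iter k (mstep P) (0, st) = (pc, st') /\ size P <= pc.

Definition rename_instr (rho jmp : nat -> nat) (c : instr) : instr :=
  match c with Inc r => Inc (rho r) | Dec r j => Dec (rho r) (jmp j) end.

(* Every exit of [P] is redirected to the first address after the copy. *)
Definition reloc (rho : nat -> nat) (o : nat) (P : seq instr) : seq instr :=
  [seq rename_instr rho (fun j => o + minn j (size P)) c | c <- P].

Lemma size_reloc rho o P : size (reloc rho o P) = size P.
Proof. exact: size_map. Qed.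

Lemma upd_same st r v : upd st r v r = v.
Proof. by rewrite /upd eqxx. Qed.

Lemma upd_neq st r v i : i != r -> upd st r v i = st i.
Proof. by rewrite /upd => /negbTE ->. Qed.

Lemma upd_rename rho s r v : injective rho ->
  (fun i => upd s (rho r) v (rho i)) = upd (fun i => s (rho i)) r v.
Proof.
by move=> inj; apply: functional_extensionality => i; rewrite /upd (inj_eq inj).
Qed.

Lemma mstep_halted P pc st : size P <= pc -> mstep P (pc, st) = (pc, st).
Proof. by rewrite /mstep ltnNge => ->. Qed.

Lemma iter_halted P k pc st : size P <= pc -> iter k (mstep P) (pc, st) = (pc, st).
Proof. by move=> h; elim: k => //= k ->; rewrite mstep_halted. Qed.

Definition frame_eq (rho s s' : nat -> nat) : Prop :=
  forall j, (forall i, j != rho i) -> s' j = s j.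

Lemma mstep_reloc rho P A B pc s pc' st' : injective rho -> pc < size P ->
  mstep P (pc, fun i => s (rho i)) = (pc', st') ->
  exists s', [/\ mstep (A ++ reloc rho (size A) P ++ B) (size A + pc, s) =
                   (size A + minn pc' (size P), s'),
                 (fun i => s' (rho i)) = st' & frame_eq rho s s'].
Proof.
move=> inj lt; rewrite /mstep lt.
have -> : size A + pc < size (A ++ reloc rho (size A) P ++ B).
  by rewrite !size_cat size_reloc ltn_add2l; apply: leq_trans lt (leq_addr _ _).
have -> : nth (Inc 0) (A ++ reloc rho (size A) P ++ B) (size A + pc) =
   rename_instr rho (fun j => size A + minn j (size P)) (nth (Inc 0) P pc).
  rewrite nth_cat ltnNge leq_addr /= addKn nth_cat size_reloc lt.
  by rewrite (nth_map (Inc 0)).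
have mS : minn pc.+1 (size P) = pc.+1 by apply/minn_idPl.
have fr r v : frame_eq rho s (upd s (rho r) v) by move=> j /(_ r) /upd_neq ->.
case: (nth _ P pc) => [r|r j] /=.
  move=> [<- <-]; exists (upd s (rho r) (s (rho r)).+1).
  by rewrite mS addnS upd_rename.
case: ifP => _ [<- <-]; first by exists s; split=> // j.
by exists (upd s (rho r) (s (rho r)).-1); rewrite mS addnS upd_rename.
Qed.

Lemma exec_reloc rho P A B s st' : injective rho -> exec P (fun i => s (rho i)) st' ->
  exists k s', [/\ iter k (mstep (A ++ reloc rho (size A) P ++ B)) (size A, s) =
                     (size A + size P, s'),
                   (fun i => s' (rho i)) = st' & frame_eq rho s s'].
Proof.
move=> inj [k [pc' [run le]]].
set Q := A ++ _.
have [] : exists k' s', [/\ iter k' (mstep Q) (size A + minn 0 (size P), s) =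
                     (size A + minn pc' (size P), s'),
                   (fun i => s' (rho i)) = st' & frame_eq rho s s'].
  elim: k 0 s run => [|k IH] pc s run.
    by move: run => /= [-> <-]; exists 0, s; split=> // j.
  have [lt|ge] := ltnP pc (size P); last first.
    (* A halted [P] idles for its remaining steps, whereas its copy would go on into [B]; hence the
       copy may take fewer steps than [k]. *)
    move: run; rewrite iter_halted // => -[<- <-]; exists 0, s.
    by rewrite (minn_idPr ge); split=> // j.
  rewrite iterSr in run.
  case E: (mstep P _) run => [pc1 st1] run.
  have [s1 [E1 Es1 f1]] := mstep_reloc rho P A B pc s pc1 st1 inj lt E.
  rewrite -Es1 in run; have [k' [s' [r' e' f']]] := IH _ _ run.
  exists k'.+1, s'; split=> //; last by move=> j h; rewrite f' ?f1.
  by rewrite iterSr E1.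
move=> k' [s' []]; rewrite min0n addn0 (minn_idPr le) => r e f.
by exists k', s'.
Qed.

Lemma exec_embed P A B st st' : exec P st st' ->
  exists k, iter k (mstep (A ++ reloc id (size A) P ++ B)) (size A, st) =
            (size A + size P, st').
Proof.
move=> /(exec_reloc id P A B st st' (@inj_id _)) [k [s' [r e _]]].
by exists k; rewrite r -e.
Qed.

Definition seqm (P1 P2 : seq instr) : seq instr :=
  reloc id 0 P1 ++ reloc id (size P1) P2.

Lemma exec_seqm P1 P2 a b c : exec P1 a b -> exec P2 b c -> exec (seqm P1 P2) a c.
Proof.
move=> /(exec_embed P1 [::] (reloc id (size P1) P2)) [k1 r1].
move=> /(exec_embed P2 (reloc id 0 P1) [::]) [k2].
rewrite cats0 size_reloc => r2; exists (k2 + k1), (size P1 + size P2); split.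
  by rewrite iterD r1 add0n.
by rewrite size_cat !size_reloc.
Qed.

(* With [0] in register [z], [Dec z j] is an unconditional jump to [j]. *)
Definition loopm (z r : nat) (P : seq instr) : seq instr :=
  Dec r (size P).+2 :: reloc id 1 P ++ [:: Dec z 0].

Lemma exec_loopm0 z r P st : st r = 0 -> exec (loopm z r P) st st.
Proof.
move=> h; exists 1, (size P).+2; rewrite /= h /=; split=> //.
by rewrite size_cat size_reloc addn1.
Qed.

Lemma exec_loopmS z r P st n st1 st2 : st r = n.+1 -> st1 z = 0 ->
  exec P (upd st r n) st1 -> exec (loopm z r P) st1 st2 ->
  exec (loopm z r P) st st2.
Proof.
move=> h hz /(exec_embed P [:: Dec r (size P).+2] [:: Dec z 0]) [k1 r1].
(* One step decrements [r], [k1] steps run the body, one step jumps back to the test, and [k2] steps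
   finish the loop. *)
move=> [k2 [pc [r2 le]]]; exists (k2 + (1 + (k1 + 1))), pc; split=> //.
rewrite iterD [iter (1 + _) _ _]iterD [iter (k1 + _) _ _]iterD.
have -> : iter 1 (mstep (loopm z r P)) (0, st) = (1, upd st r n).
  by rewrite /= h.
rewrite r1 -r2; congr (iter k2 _ _); rewrite /= size_cat size_reloc addn1 ltnSn.
by rewrite nth_cat size_reloc ltnn subnn /= hz.
Qed.

(** [P1] is the nonzero branch and starts with [r] already decremented; [Dec z] then jumps over
    [P2]. *)
Definition ifm (z r : nat) (P1 P2 : seq instr) : seq instr :=
  (Dec r (size P1).+2 :: reloc id 1 P1) ++
  Dec z ((size P1).+2 + size P2) :: reloc id (size P1).+2 P2.

Lemma exec_ifm0 z r P1 P2 st st' : st r = 0 -> exec P2 st st' ->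
  exec (ifm z r P1 P2) st st'.
Proof.
move=> h /(exec_embed P2 (Dec r (size P1).+2 :: reloc id 1 P1 ++
  [:: Dec z ((size P1).+2 + size P2)]) [::]) [k].
rewrite /= size_cat size_reloc addn1 cats0 -catA /= => run.
exists k.+1, ((size P1).+2 + size P2); rewrite iterSr /=; split.
  by rewrite h.
by rewrite size_cat /= !size_reloc addnS.
Qed.

Lemma exec_ifmS z r P1 P2 st n st' : st r = n.+1 -> st' z = 0 ->
  exec P1 (upd st r n) st' -> exec (ifm z r P1 P2) st st'.
Proof.
move=> h hz /(exec_embed P1 [:: Dec r (size P1).+2]
  (Dec z ((size P1).+2 + size P2) :: reloc id (size P1).+2 P2)) [k run].
exists (1 + (k + 1)), ((size P1).+2 + size P2); split; last first.
  by rewrite size_cat /= !size_reloc addnS.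
rewrite iterD [iter (k + _) _ _]iterD.
have -> : iter 1 (mstep (ifm z r P1 P2)) (0, st) = (1, upd st r n).
  by rewrite /= h.
rewrite run /= size_cat size_reloc /= ltnS addnS ltnS leq_addr.
by rewrite nth_cat size_reloc ltnn subnn /= hz.
Qed.

Lemma exec_nil st : exec [::] st st.
Proof. by exists 0, 0. Qed.

Lemma exec_inc r st : exec [:: Inc r] st (upd st r (st r).+1).
Proof. by exists 1, 1. Qed.

(** * Register contents as finite lists, and elementary register operations *)

Definition vec (l : seq nat) : nat -> nat := nth 0 l.

Lemma upd_vec l i v : upd (vec l) i v = vec (set_nth 0 l i v).
Proof.
by apply: functional_extensionality => j; rewrite /vec nth_set_nth.
Qed.

(** All registers other than 0 must be zero again at the halt, which [runs] does not ask; this is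
    what makes programs reusable inside others. *)
Definition implements (P : seq instr) (f : nat -> nat) : Prop :=
  forall x, exec P (vec [:: x]) (vec [:: f x]).

Definition computable (f : nat -> nat) : Prop := exists P, implements P f.

(* Runs [P] in place on register [i]; its other registers are moved above [o]. *)
Definition call (o i : nat) (P : seq instr) : seq instr :=
  reloc (fun k => if k == 0 then i else o + k) 0 P.

(** The renaming is injective because [i <= o], and above [o] the list [l] has only zeros, so the
    copy of [P] starts from its clean initial state and leaves zeros behind. *)
Lemma exec_call o i P f l : implements P f -> i <= o -> size l <= o.+1 ->
  exec (call o i P) (vec l) (vec (set_nth 0 l i (f (nth 0 l i)))).
Proof.
move=> imp io sz; rewrite /call; set rho := (X in reloc X).
have inj : injective rho by rewrite /rho => -[|a] [|b] //=; lia.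
have hl : (fun k => vec l (rho k)) = vec [:: nth 0 l i].
  apply: functional_extensionality => -[//|k]; rewrite /vec /rho /=.
  by rewrite nth_nil nth_default //; lia.
have := imp (nth 0 l i); rewrite -hl.
move=> /(exec_reloc rho P [::] [::] _ _ inj) [k [s' [r e fr]]].
exists k, (size P); rewrite cats0 in r; split; last by rewrite size_reloc.
rewrite r; congr (_, _); apply: functional_extensionality => j.
rewrite -upd_vec /upd; case: eqP => [->|/eqP ji].
  by have := congr1 (fun g => g 0) e.
have [jo|oj] := leqP j o.
  apply: fr => -[|m]; rewrite /rho /= ?(negbTE ji) //; lia.
have ej : rho (j - o) = j by rewrite /rho; case: eqP; lia.
have := congr1 (fun g => g (j - o)) e; rewrite ej => ->.
rewrite /vec nth_default /=; last lia.
by rewrite nth_default //; lia.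
Qed.

Ltac upd_ext :=
  apply: functional_extensionality => k; rewrite /upd;
  repeat (let e := fresh in case: eqP => [e|?]; rewrite ?e //=); lia.

Definition move (z i j : nat) : seq instr := loopm z i [:: Inc j].

Lemma exec_move z i j st : i != j -> z != i -> z != j -> st z = 0 ->
  exec (move z i j) st (upd (upd st i 0) j (st j + st i)).
Proof.
move=> ij zi zj; move E: (st i) => n; elim: n st E => [|n IH] st E hz.
  have -> : upd (upd st i 0) j (st j + 0) = st by upd_ext.
  exact: exec_loopm0.
have h1 : upd (upd st i n) j (upd st i n j).+1 i = n.
  by rewrite upd_neq // upd_same.
have h2 : upd (upd st i n) j (upd st i n j).+1 z = 0 by rewrite !upd_neq.
apply: (exec_loopmS _ _ _ _ _ _ _ E h2); first exact: exec_inc.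
have := IH _ h1 h2; congr (exec _ _ _).
upd_ext.
Qed.

(** Reading a register empties it: [i] is drained into both [j] and [t], then restored from [t]. *)
Definition copy (z t i j : nat) : seq instr :=
  seqm (loopm z i (seqm [:: Inc j] [:: Inc t])) (move z t i).

Lemma exec_copy (z t i j : nat) (st : nat -> nat) : uniq [:: z; t; i; j] -> st z = 0 -> st t = 0 ->
  exec (copy z t i j) st (upd st j (st j + st i)).
Proof.
rewrite /= !inE !negb_or !andbT => /andP[/and3P[zt zi zj]] /andP[/andP[ti tj] ij].
move=> hz ht; have it : i != t by rewrite eq_sym.
have run : exec (loopm z i (seqm [:: Inc j] [:: Inc t])) st
   (upd (upd (upd st i 0) j (st j + st i)) t (st t + st i)).
  move: hz {ht}; move E: (st i) => n; elim: n st E => [|n IH] st E hz.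
    have -> : upd (upd (upd st i 0) j (st j + 0)) t (st t + 0) = st by upd_ext.
    exact: exec_loopm0.
  set st1 := upd (upd (upd st i n) j (st j).+1) t (st t).+1.
  have h1 : st1 i = n by rewrite /st1 2?upd_neq // upd_same.
  have h2 : st1 z = 0 by rewrite /st1 !upd_neq.
  apply: (exec_loopmS _ _ _ _ _ st1 _ E h2).
    apply: exec_seqm; first exact: exec_inc.
    have := exec_inc t (upd (upd st i n) j (upd st i n j).+1).
    by congr (exec _ _ _); rewrite /st1; upd_ext.
  by have := IH _ h1 h2; congr (exec _ _ _); rewrite /st1; upd_ext.
apply: exec_seqm run _.
have := exec_move z t i (upd (upd (upd st i 0) j (st j + st i)) t (st t + st i)) ti zt zi.
move=> /(_ _) H; have {}H := H (ltac:(by rewrite !upd_neq)).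
by move: H; congr (exec _ _ _); upd_ext.
Qed.

Definition clear (z r : nat) : seq instr := loopm z r [::].

Lemma exec_clear z r st : z != r -> st z = 0 -> exec (clear z r) st (upd st r 0).
Proof.
move=> zr; move E: (st r) => n; elim: n st E => [|n IH] st E hz.
  have -> : upd st r 0 = st by upd_ext.
  exact: exec_loopm0.
apply: (exec_loopmS _ _ _ _ _ (upd st r n) _ E); first by rewrite upd_neq.
  exact: exec_nil.
have := IH (upd st r n) (upd_same _ _ _); rewrite upd_neq // => /(_ hz).
by congr (exec _ _ _); upd_ext.
Qed.

Fixpoint clear_upto (z n : nat) : seq instr :=
  if n is m.+1 then seqm (clear_upto z m) (clear z n) else [::].

Lemma exec_clear_upto z n st : n < z -> st z = 0 ->
  exec (clear_upto z n) st (fun i => if 0 < i <= n then 0 else st i).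
Proof.
elim: n => [|n IH] nz hz.
  have -> : (fun i => if 0 < i <= 0 then 0 else st i) = st.
    by apply: functional_extensionality => -[].
  exact: exec_nil.
apply: exec_seqm (IH (ltnW nz) hz) _.
have := exec_clear z n.+1 (fun i => if 0 < i <= n then 0 else st i).
rewrite hz [z <= n]leqNgt (ltnW nz) andbF => /(_ _ erefl); rewrite gtn_eqF // => /(_ erefl).
congr (exec _ _ _); apply: functional_extensionality => k; rewrite /upd.
by rewrite [k <= n.+1]leq_eqVlt ltnS; case: eqP => [->|].
Qed.

Definition reg_of (c : instr) : nat := match c with Inc r | Dec r _ => r end.

Lemma reg_bound P : exists W, all (fun c => reg_of c < W) P.
Proof.
elim: P => [|c P [W H]]; first by exists 0.
exists (maxn (reg_of c).+1 W); apply/andP; split; first exact: leq_maxl.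
by apply: sub_all H => c' h; apply: leq_trans h (leq_maxr _ _).
Qed.

Lemma exec_above P W st st' j : all (fun c => reg_of c < W) P -> exec P st st' ->
  W <= j -> st' j = st j.
Proof.
move=> HP [k [pc [run _]]] Wj; elim: k 0 st run => [|k IH] n st; first by case=> _ ->.
rewrite iterSr; case E: (mstep P _) => [n1 st1] /IH ->; move: E; rewrite /mstep.
case: ifP => lt; last by case=> _ <-.
have := all_nthP (Inc 0) HP _ lt; case: (nth _ P n) => [r|r j'] /= h.
  by case=> _ <-; rewrite upd_neq //; lia.
by case: ifP => _ [_ <-] //; rewrite upd_neq //; lia.
Qed.

Lemma vec_ext l l' : (forall i, nth 0 l i = nth 0 l' i) -> vec l = vec l'.
Proof. exact: functional_extensionality. Qed.

(** A program mentions finitely many registers, so code that clears them can be appended; the others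
    were zero from the start. *)
Lemma runs_clean M :
  exists P, forall x y, runs M x y -> exec P (vec [:: x]) (vec [:: y]).
Proof.
have [W HW] := reg_bound M.
(* Register [W.+1] is never touched by [M], so it still holds the zero that unconditional jumps
   require. *)
exists (seqm M (clear_upto W.+1 W)) => x y [k].
case E: (iter k _ _) => [pc st] [le <-].
have run : exec M (vec [:: x]) st.
  exists k, pc; split=> //; rewrite -E; congr (iter _ _ (_, _)).
  by apply: functional_extensionality => -[|i]; rewrite /vec /upd //= nth_nil.
apply: (exec_seqm _ _ _ _ _ run).
have ab j : W <= j -> 0 < j -> st j = 0.
  move=> Wj; rewrite (exec_above _ _ _ _ _ HW run Wj).
  by case: j {Wj} => // j; rewrite /vec /= nth_nil.
have := exec_clear_upto W.+1 W st (ltnSn _) (ab _ (leqnSn _) isT).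
congr (exec _ _ _); apply: functional_extensionality => -[|j] //=.
by rewrite /vec /= nth_nil; case: ltnP => // h; rewrite ab // leqW.
Qed.

Lemma exec_vec_loop0 z r P l : nth 0 l r = 0 -> exec (loopm z r P) (vec l) (vec l).
Proof. exact: exec_loopm0. Qed.

Lemma exec_vec_loopS z r P l n l1 st2 : nth 0 l r = n.+1 -> nth 0 l1 z = 0 ->
  exec P (vec (set_nth 0 l r n)) (vec l1) ->
  exec (loopm z r P) (vec l1) st2 -> exec (loopm z r P) (vec l) st2.
Proof. by rewrite -upd_vec; apply: exec_loopmS. Qed.

Lemma exec_vec_inc r l : exec [:: Inc r] (vec l) (vec (set_nth 0 l r (nth 0 l r).+1)).
Proof. by rewrite -upd_vec; apply: exec_inc. Qed.

Lemma exec_vec_move z i j l : i != j -> z != i -> z != j -> nth 0 l z = 0 ->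
  exec (move z i j) (vec l)
    (vec (set_nth 0 (set_nth 0 l i 0) j (nth 0 l j + nth 0 l i))).
Proof. by rewrite -!upd_vec; apply: exec_move. Qed.

Lemma exec_vec_copy (z t i j : nat) l : uniq [:: z; t; i; j] -> nth 0 l z = 0 -> nth 0 l t = 0 ->
  exec (copy z t i j) (vec l) (vec (set_nth 0 l j (nth 0 l j + nth 0 l i))).
Proof. by rewrite -!upd_vec; apply: exec_copy. Qed.

Lemma exec_vec_clear z r l : z != r -> nth 0 l z = 0 ->
  exec (clear z r) (vec l) (vec (set_nth 0 l r 0)).
Proof. by rewrite -upd_vec; apply: exec_clear. Qed.

(** * Cantor pairing and its machines *)

Lemma cpairS a b : cpair a b.+1 = (cpair a.+1 b).+1.
Proof. by rewrite /cpair addSnnS addnS. Qed.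

Lemma triangleS n : (n.+1 * n.+2)./2 = (n * n.+1)./2 + n.+1.
Proof.
have -> : n.+1 * n.+2 = n * n.+1 + n.+1.*2 by lia.
by rewrite halfD odd_double andbF doubleK.
Qed.

Lemma cpair0S b : cpair b.+1 0 = (cpair 0 b).+1.
Proof. by rewrite /cpair !addn0 add0n triangleS addnS. Qed.

(** The successor in Cantor's enumeration: a move along the antidiagonal, or to the start of the
    next one. Iterating it inverts the pairing without extracting a square root. *)
Definition cnext (p : nat * nat) : nat * nat :=
  if p.1 is a.+1 then (a, p.2.+1) else (p.2.+1, 0).

Definition unpair (n : nat) : nat * nat := iter n cnext (0, 0).

Lemma cpairK a b : unpair (cpair a b) = (a, b).
Proof.
move E: (a + b) => s; elim: s a b E => [|s IHs] a b.
  by case: a b => [|a] [|b].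
elim: b a => [|b IHb] a E; last by rewrite cpairS /unpair iterS -/(unpair _) IHb //; lia.
have -> : a = s.+1 by lia.
by rewrite cpair0S /unpair iterS -/(unpair _) IHs.
Qed.

Lemma unpairK n : cpair (unpair n).1 (unpair n).2 = n.
Proof.
elim: n => // n; rewrite /unpair iterS -/(unpair n); case: (unpair n) => -[|a] b /= <-.
  by rewrite cpair0S.
by rewrite cpairS.
Qed.

(** The first loop leaves [a + b] in register 0 and [b] in register 2; the second adds the
    triangular number of [a + b] to register 2 as the sum of the integers up to [a + b]. Register 9
    supplies the zero for jumps and register 3 is scratch. *)
Definition pair_prog : seq instr :=
  seqm (loopm 9 1 (seqm [:: Inc 0] [:: Inc 2]))
  (seqm (loopm 9 0 (seqm [:: Inc 2] (copy 9 3 0 2))) (move 9 2 0)).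

Lemma exec_pair a b : exec pair_prog (vec [:: a; b; 0; 0]) (vec [:: cpair a b; 0; 0; 0]).
Proof.
have run1 c : exec (loopm 9 1 (seqm [:: Inc 0] [:: Inc 2]))
    (vec [:: a; b; c; 0]) (vec [:: a + b; 0; c + b; 0]).
  elim: b a c => [|b IH] a' c; first by rewrite !addn0; apply: exec_vec_loop0.
  apply: (exec_vec_loopS _ _ _ _ b [:: a'.+1; b; c.+1; 0]) => //.
    apply: exec_seqm; first exact: exec_vec_inc.
    exact: (exec_vec_inc 2).
  by rewrite !addnS -!addSn.
apply: (exec_seqm _ _ _ _ _ (run1 0)); rewrite add0n.
have run2 s c : exec (loopm 9 0 (seqm [:: Inc 2] (copy 9 3 0 2)))
    (vec [:: s; 0; c; 0]) (vec [:: 0; 0; (s * s.+1)./2 + c; 0]).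
  elim: s c => [|s IH] c; first exact: exec_vec_loop0.
  apply: (exec_vec_loopS _ _ _ _ s [:: s; 0; c.+1 + s; 0]) => //.
    apply: exec_seqm; first exact: exec_vec_inc.
    exact: (exec_vec_copy 9 3 0 2).
  by have := IH (c.+1 + s); congr (exec _ _ (vec [:: _; _; _; _])); rewrite triangleS; lia.
apply: exec_seqm (run2 _ _) _.
exact: exec_vec_move.
Qed.

Definition unpair_prog : seq instr :=
  loopm 9 0 (ifm 9 1 [:: Inc 2] (seqm (move 9 2 1) [:: Inc 1])).

Lemma exec_unpair n :
  exec unpair_prog (vec [:: n; 0; 0]) (vec [:: 0; (unpair n).1; (unpair n).2]).
Proof.
rewrite /unpair.
suff run p : exec unpair_prog (vec [:: n; p.1; p.2])
   (vec [:: 0; (iter n cnext p).1; (iter n cnext p).2]) by exact: run (0, 0).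
elim: n p => [|n IH] p; first exact: exec_vec_loop0.
rewrite iterSr.
apply: (exec_vec_loopS _ _ _ _ n [:: n; (cnext p).1; (cnext p).2]) => //.
case: p => -[|a] b /=.
  apply: exec_ifm0 => //; apply: exec_seqm; first exact: exec_vec_move.
  exact: exec_vec_inc.
apply: (exec_ifmS _ _ _ _ _ a) => //; rewrite upd_vec; exact: exec_vec_inc.
Qed.

(** * Functions computed by register machines *)

Lemma eq_computable f g : f =1 g -> computable f -> computable g.
Proof. by move=> /functional_extensionality ->. Qed.

Lemma computable_id : computable id.
Proof. by exists [::] => x; apply: exec_nil. Qed.

Lemma computable_comp f g : computable f -> computable g -> computable (f \o g).
Proof. by move=> [P hP] [Q hQ]; exists (seqm Q P) => x; apply: exec_seqm (hQ x) (hP (g x)). Qed.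

Lemma computable_succ : computable S.
Proof. by exists [:: Inc 0] => x; apply: (exec_vec_inc 0). Qed.

Lemma computable_const c : computable (fun=> c).
Proof.
elim: c => [|c IH]; first by exists (clear 9 0) => x; apply: (exec_vec_clear 9 0).
exact: computable_comp computable_succ IH.
Qed.

Lemma computable_pair f g : computable f -> computable g ->
  computable (fun x => cpair (f x) (g x)).
Proof.
move=> [P hP] [Q hQ].
exists (seqm (copy 9 3 0 1) (seqm (call 10 0 P) (seqm (call 10 1 Q) pair_prog))) => x.
have -> : vec [:: x] = vec [:: x; 0; 0; 0] by apply: vec_ext => -[|[|[|[|[|i]]]]].
apply: exec_seqm; first exact: exec_vec_copy.
apply: exec_seqm; first exact: exec_call hP _ _.
apply: exec_seqm; first exact: exec_call hQ _ _.
rewrite /= add0n; have -> : vec [:: cpair (f x) (g x)] = vec [:: cpair (f x) (g x); 0; 0; 0].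
  by apply: vec_ext => -[|[|[|[|[|i]]]]].
exact: exec_pair.
Qed.

Definition cfst (n : nat) : nat := (unpair n).1.
Definition csnd (n : nat) : nat := (unpair n).2.

Lemma cfst_pair a b : cfst (cpair a b) = a. Proof. by rewrite /cfst cpairK. Qed.
Lemma csnd_pair a b : csnd (cpair a b) = b. Proof. by rewrite /csnd cpairK. Qed.

Lemma vec_pad3 x : vec [:: x] = vec [:: x; 0; 0].
Proof. by apply: vec_ext => -[|[|[|[|i]]]]. Qed.

Lemma computable_fst : computable cfst.
Proof.
exists (seqm unpair_prog (seqm (move 9 1 0) (clear 9 2))) => x.
rewrite !vec_pad3; apply: exec_seqm; first exact: exec_unpair.
apply: exec_seqm; first exact: exec_vec_move.
exact: exec_vec_clear.
Qed.

Lemma computable_snd : computable csnd.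
Proof.
exists (seqm unpair_prog (seqm (move 9 2 0) (clear 9 1))) => x.
rewrite !vec_pad3; apply: exec_seqm; first exact: exec_unpair.
apply: exec_seqm; first exact: exec_vec_move.
exact: exec_vec_clear.
Qed.

(** Iteration with a computed number of rounds takes the place of primitive recursion in what
    follows. *)
Lemma computable_iter f : computable f -> computable (fun x => iter (cfst x) f (csnd x)).
Proof.
move=> [P hP]; exists (seqm unpair_prog (seqm (loopm 9 1 (call 10 2 P)) (move 9 2 0))) => x.
rewrite !vec_pad3; apply: exec_seqm; first exact: exec_unpair.
rewrite -/(cfst x) -/(csnd x); move: (cfst x) (csnd x) => n y.
apply: (exec_seqm _ _ _ (vec [:: 0; 0; iter n f y])); last exact: exec_vec_move.
elim: n y => [|n IH] y; first exact: exec_vec_loop0.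
rewrite iterSr.
apply: (exec_vec_loopS _ _ _ _ n [:: 0; n; f y]) => //; exact: exec_call hP _ _.
Qed.

(** Unbounded search: the hypotheses make [h x] the least zero of [g], so the loop ends there.
    Register 0 keeps the candidate paired with [x], and register 1 the value of the test. *)
Lemma computable_min g h : computable g ->
  (forall x, g (cpair (h x) x) = 0) ->
  (forall x k, k < h x -> g (cpair k x) != 0) -> computable h.
Proof.
move=> [P hP] h0 hmin.
have [Q hQ] : computable (fun p => cpair (cfst p).+1 (csnd p)).
  apply: computable_pair computable_snd.
  exact: computable_comp computable_succ computable_fst.
have [Z hZ] : computable (fun x => cpair 0 x).
  exact: computable_pair (computable_const 0) computable_id.
have [E hE] := computable_fst.
pose test := seqm (copy 9 3 0 1) (call 10 1 P).
(* Entering the loop only decremented register 1, so its remainder is discarded before the next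
   test. *)
pose body := seqm (clear 9 1) (seqm (call 10 0 Q) test).
have exec_test p : exec test (vec [:: p; 0; 0; 0]) (vec [:: p; g p; 0; 0]).
  apply: exec_seqm; first exact: exec_vec_copy.
  exact: exec_call hP _ _.
exists (seqm Z (seqm test (seqm (loopm 9 1 body) E))) => x.
apply: exec_seqm; first exact: hZ.
have pad p : vec [:: p] = vec [:: p; 0; 0; 0].
  by apply: vec_ext => -[|[|[|[|[|i]]]]].
rewrite pad; apply: exec_seqm; first exact: exec_test.
have run m k : k + m = h x ->
  exec (loopm 9 1 body) (vec [:: cpair k x; g (cpair k x); 0; 0])
     (vec [:: cpair (h x) x; 0; 0; 0]).
  elim: m k => [|m IH] k km.
    have -> : k = h x by lia.
    by rewrite h0; apply: exec_vec_loop0.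
  have : g (cpair k x) != 0 by apply: hmin; lia.
  case G : (g _) => [//|n] _.
  apply: (exec_vec_loopS _ _ _ _ n [:: cpair k.+1 x; g (cpair k.+1 x); 0; 0]) => //;
    last by apply: IH; lia.
  apply: exec_seqm; first exact: exec_vec_clear.
  apply: exec_seqm; first exact: exec_call hQ _ _.
  by rewrite /= cfst_pair csnd_pair; apply: exec_test.
apply: exec_seqm; first exact: (run (h x)).
by rewrite -pad; have := hE (cpair (h x) x); rewrite cfst_pair.
Qed.

Lemma computable_cfst f : computable f -> computable (fun x => cfst (f x)).
Proof. exact: computable_comp computable_fst. Qed.

Lemma computable_csnd f : computable f -> computable (fun x => csnd (f x)).
Proof. exact: computable_comp computable_snd. Qed.

Lemma computable_iter_fun f n y : computable f -> computable n -> computable y ->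
  computable (fun x => iter (n x) f (y x)).
Proof.
move=> hf hn hy; have := computable_comp _ _ (computable_iter f hf) (computable_pair _ _ hn hy).
by apply: eq_computable => x /=; rewrite cfst_pair csnd_pair.
Qed.

Lemma computable_predn : computable predn.
Proof.
(* Kleene's device: iterating this step from [(0, 0)] reaches [(n.-1, n)]. *)
pose step p := cpair (csnd p) (csnd p).+1.
have hs : computable step.
  apply: computable_pair computable_snd _.
  exact: computable_comp computable_succ computable_snd.
have := computable_cfst _ (computable_iter_fun step id (fun=> cpair 0 0) hs computable_id
  (computable_const _)).
apply: eq_computable => n; suff -> : iter n step (cpair 0 0) = cpair n.-1 n by rewrite cfst_pair.
by elim: n => //= n ->; rewrite /step csnd_pair.
Qed.

Lemma computable_subn f g : computable f -> computable g ->
  computable (fun x => f x - g x).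
Proof.
move=> hf hg; have := computable_iter_fun predn g f computable_predn hg hf.
by apply: eq_computable => x; rewrite iter_predn.
Qed.

Lemma computable_addn f g : computable f -> computable g ->
  computable (fun x => f x + g x).
Proof.
move=> hf hg; have := computable_iter_fun S g f computable_succ hg hf.
by apply: eq_computable => x; rewrite iter_succn addnC.
Qed.

Lemma computable_mul_exp2 f n : computable f -> computable (fun x => 2 ^ n * f x).
Proof.
move=> hf; elim: n => [|n IH]; first by apply: eq_computable hf => x; rewrite mul1n.
by apply: eq_computable (computable_addn _ _ IH IH) => x; rewrite expnS; lia.
Qed.

Lemma computable_if f g h : computable f -> computable g -> computable h ->
  computable (fun x => if f x == 0 then g x else h x).
Proof.
(* One or more steps turn [(g x, h x)] into [(h x, h x)], so after [f x] steps the first component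
   is the required value. *)
move=> hf hg hh; pose step p := cpair (csnd p) (csnd p).
have hs : computable step by exact: computable_pair computable_snd computable_snd.
have := computable_cfst _ (computable_iter_fun step f _ hs hf (computable_pair _ _ hg hh)).
apply: eq_computable => x; case: (f x) => [|n]; first by rewrite cfst_pair.
suff -> : iter n.+1 step (cpair (g x) (h x)) = cpair (h x) (h x) by rewrite cfst_pair.
by elim: n => [|n IH]; [rewrite /= /step csnd_pair | rewrite iterS IH /step csnd_pair].
Qed.

(** * Codes of strings and of lists *)

Lemma scode_rcons s b : scode (rcons s b) = 2 * scode s + 1 + b.
Proof. by rewrite /scode -cats1 foldl_cat. Qed.

Lemma scode_inj : injective scode.
Proof.
move=> s; elim/last_ind: s => [|s b IH] t; elim/last_ind: t => [|t b' _] //.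
- by rewrite scode_rcons /scode /=; lia.
- by rewrite scode_rcons /scode /=; lia.
rewrite !scode_rcons => e; have eb : b = b' by case: b b' e => -[]; lia.
by congr rcons => //; apply: IH; move: e; rewrite eb; lia.
Qed.

(** In bijective base 2, the last digit of [n.+1] is the parity of [n], and the remaining digits
    have code [n./2]. *)
Lemma scode_surj n : exists s, scode s = n.
Proof.
elim/ltn_ind: n => -[|n] IH; first by exists [::].
have [s hs] := IH n./2 (ltac:(by rewrite ltnS; lia)).
exists (rcons s (odd n)); rewrite scode_rcons hs.
by have := odd_double_half n; lia.
Qed.

Definition sdec (n : nat) : seq bool :=
  proj1_sig (constructive_indefinite_description _ (scode_surj n)).

Lemma sdecK n : scode (sdec n) = n.
Proof. by rewrite /sdec; case: constructive_indefinite_description. Qed.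

Lemma scodeK s : sdec (scode s) = s.
Proof. by apply: scode_inj; rewrite sdecK. Qed.

Definition ncode (l : seq nat) : nat := foldr (fun a r => (cpair a r).+1) 0 l.

Lemma lcodeE l : lcode l = ncode (map scode l).
Proof. by elim: l => //= s l ->. Qed.

Lemma ncode_inj : injective ncode.
Proof.
elim=> [|a l IH] [|b m] //= [e].
have := cfst_pair a (ncode l); have := csnd_pair a (ncode l).
by rewrite e cfst_pair csnd_pair => /esym /IH -> ->.
Qed.

Lemma lcode_inj : injective lcode.
Proof. by move=> l m; rewrite !lcodeE => /ncode_inj /(inj_map scode_inj). Qed.

Lemma leq_cpair a b : b <= cpair a b.
Proof. exact: leq_addl. Qed.

Lemma size_ncode l : size l <= ncode l.
Proof. by elim: l => //= a l IH; rewrite ltnS (leq_trans IH) // leq_cpair. Qed.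

(** The state pairs the code of the remaining list with that of an accumulator, hence the reversal.
    The step idles on the empty list, whose code is 0, so any number of iterations at least the
    length will do; the code itself is one. *)
Definition revmap_step (g : nat -> nat) (p : nat) : nat :=
  if cfst p == 0 then p
  else cpair (csnd (cfst p).-1) (cpair (g (cfst (cfst p).-1)) (csnd p)).+1.

Definition revmap (g : nat -> nat) (n : nat) : nat :=
  csnd (iter n (revmap_step g) (cpair n 0)).

Lemma revmapE g l : revmap g (ncode l) = ncode (rev (map g l)).
Proof.
have run k m acc : size m <= k ->
    iter k (revmap_step g) (cpair (ncode m) (ncode acc)) =
    cpair 0 (ncode (catrev (map g m) acc)).
  elim: k m acc => [|k IH] [|a m] acc //= le; rewrite -iterS iterSr {2}/revmap_step.
    by rewrite cfst_pair eqxx (IH [::]).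
  rewrite cfst_pair csnd_pair /= cfst_pair csnd_pair.
  by rewrite (IH m (g a :: acc)).
by rewrite /revmap (run _ l [::]) ?size_ncode // csnd_pair.
Qed.

Lemma computable_revmap g : computable g -> computable (revmap g).
Proof.
move=> hg; apply: computable_csnd; apply: computable_iter_fun;
  [|exact: computable_id|exact: computable_pair computable_id (computable_const 0)].
have hf := computable_fst; have hp := computable_comp _ _ computable_predn hf.
apply: computable_if hf computable_id _; apply: computable_pair.
  exact: computable_csnd.
apply: computable_comp computable_succ _; apply: computable_pair computable_snd.
by apply: computable_comp hg _; apply: computable_cfst.
Qed.

(** * Transforming the outputs of the universal machine *)

Lemma exec_runs M x y : exec M (vec [:: x]) (vec [:: y]) -> runs M x y.
Proof.
move=> [k [pc [run le]]]; exists k.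
have -> : upd (fun _ => 0) 0 x = vec [:: x].
  by apply: functional_extensionality => -[|i]; rewrite /vec /upd //= nth_nil.
by rewrite run.
Qed.

Lemma runs_computable M f : (forall x, runs M x (f x)) -> computable f.
Proof. by have [P hP] := runs_clean M; move=> h; exists P => x; apply: hP. Qed.

(** [F] searches for the least string code that [Q] sends to the transformed list; the search ends
    because [Q] is surjective. *)
Lemma computable_transducer (Q : seq bool -> seq (seq bool)) g :
  total_recursive_surjection Q -> computable g ->
  exists2 F, computable F & forall o,
    Q (sdec (F (scode o))) = [seq sdec (g (scode s)) | s <- Q o].
Proof.
move=> [[M hM] surj] hg.
pose q n := lcode (Q (sdec n)).
have hq : computable q by apply: (runs_computable M) => n; rewrite -{1}(sdecK n).
(* The outer pass undoes the reversal made by the inner one. *)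
pose target n := revmap id (revmap g (q n)).
have targetE n : target n = lcode [seq sdec (g (scode s)) | s <- Q (sdec n)].
  rewrite /target /q !lcodeE !revmapE map_id revK -!map_comp; congr ncode.
  by apply: eq_map => s /=; rewrite sdecK.
have htarget : computable target.
  apply: computable_comp (computable_revmap _ computable_id) _.
  exact: computable_comp (computable_revmap _ hg) hq.
have ex n : exists y, q y == target n.
  have [s hs] := surj [seq sdec (g (scode s)) | s <- Q (sdec n)].
  by exists (scode s); rewrite /q scodeK hs targetE.
pose F n := ex_minn (ex n).
have FE n : q (F n) = target n by apply/eqP; rewrite /F; case: ex_minnP.
have Fmin n k : k < F n -> q k != target n.
  rewrite /F; case: ex_minnP => m _ hm; rewrite ltnNge; apply: contra; exact: hm.
exists F; last first.
  by move=> o; apply: lcode_inj; rewrite -/(q _) FE targetE scodeK.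
(* With truncated subtraction, this sum vanishes exactly when the two codes agree. *)
pose dist p := (q (cfst p) - target (csnd p)) + (target (csnd p) - q (cfst p)).
apply: (computable_min dist).
- have h1 := computable_comp _ _ hq computable_fst.
  have h2 := computable_comp _ _ htarget computable_snd.
  by apply: computable_addn; apply: computable_subn.
- by move=> x; rewrite /dist cfst_pair csnd_pair FE subnn.
- by move=> x k /Fmin; rewrite /dist cfst_pair csnd_pair; lia.
Qed.

(** The machine that runs [U] and then transforms its output is itself simulated by [U] after a
    fixed prefix, whose length is the cost [c]. *)
Lemma universal_transducer U Q g :
  universal_machine U -> total_recursive_surjection Q -> computable g ->
  exists c, forall p o, U p = Some o -> exists p' o',
    [/\ U p' = Some o', size p' = c + size p &
        Q o' = [seq sdec (g (scode s)) | s <- Q o]].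
Proof.
move=> [[MU hMU] univ] hQ hg.
have [F [PF hPF] FE] := computable_transducer Q g hQ hg.
have [P hP] := runs_clean MU.
have [c hc] := univ (seqm P PF).
exists (size c) => p o Up; exists (c ++ p), (sdec (F (scode o))); split=> //.
  apply/hc/exec_runs; rewrite sdecK; apply: exec_seqm (hPF _).
  exact/hP/hMU.
exact: size_cat.
Qed.

(** The empty machine computes the identity, so its prefix followed by [o] outputs [o]. *)
Lemma universal_total U o : universal_machine U -> exists p, U p = Some o.
Proof.
move=> [_ univ]; have [c hc] := univ [::]; exists (c ++ o).
by apply/hc/exec_runs/exec_nil.
Qed.

Fixpoint select (test : nat -> nat) (l : seq (nat * nat)) (x : nat) : nat :=
  if l is (s, t) :: l' then
    if test (cpair x s) == 0 then t else select test l' x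
  else 0.

Lemma computable_select test l : computable test -> computable (select test l).
Proof.
move=> ht; elim: l => [|[s t] l IH] /=; first exact: computable_const.
apply: computable_if (computable_const t) IH; apply: computable_comp ht _.
exact: computable_pair computable_id (computable_const s).
Qed.

Lemma selectP test (l : seq (nat * nat)) x :
  (exists2 st, st \in l & test (cpair x st.1) = 0) ->
  exists2 st, st \in l & test (cpair x st.1) = 0 /\ select test l x = st.2.
Proof.
elim: l => [[st] //|[s t] l IH] [st]; rewrite inE => st_l hst /=.
case: eqP => [h|h]; first by exists (s, t); rewrite ?mem_head.
have {st_l} st_l : st \in l by case/orP: st_l => // /eqP e; rewrite e in hst.
have [st' l' h'] := IH (ex_intro2 _ _ st st_l hst).
by exists st' => //; rewrite inE l' orbT.
Qed.

(** * Changing the interpretation *)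

Local Open Scope ring_scope.

Lemma metric_ge0 X (d : X -> X -> RR) x y : is_metric d -> 0 <= d x y.
Proof.
move=> [d0 [sym tri]]; have /d0 dxx : x = x by [].
by have := tri x y x; rewrite dxx (sym y x); lra.
Qed.

Lemma exp2V_small (e : RR) : 0 < e -> exists n, 2 ^- n < e.
Proof.
move=> e0; exists (Num.bound e^-1).
have := upper_nthrootP (leqnn (Num.bound e^-1)).
by move=> h; rewrite invf_plt ?posrE ?exprn_gt0 // ?ltr0n.
Qed.

Lemma compact_net X (d : X -> X -> RR) (J : seq bool -> X) (e : RR) :
  compact_metric d -> interpretation d J -> 0 < e ->
  exists l : seq (seq bool), forall x, exists2 t, t \in l & d (J t) x < e.
Proof.
move=> [[d0 [sym tri]] cpt] dense e0.
have [t x|x|l hl] := cpt _ (fun t x => d (J t) x < e).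
- move=> h; exists (e - d (J t) x); split=> [|y hy]; first by rewrite subr_gt0.
  by have := tri (J t) x y; lra.
- by have [t ht] := dense x e e0; exists t.
exists l => x; have [t [tl h]] := hl x; exists t => //.
elim: {hl} l tl => //= u l IH [->|/IH]; first exact: mem_head.
by rewrite inE => ->; rewrite orbT.
Qed.

(* The code of a rational [+-b/(c+1)] passes iff [b/(c+1) <= 2 * 2^-n]; as distances are
   nonnegative, the sign of the approximation is irrelevant. *)
Lemma computable_near X (d : X -> X -> RR) I n : is_metric d ->
  computable_interpretation d I ->
  exists2 test, computable test & forall s t,
    (d (I s) (I t) <= 2 ^- n -> test (cpair (scode s) (scode t)) = 0%N) /\
    (test (cpair (scode s) (scode t)) = 0%N -> d (I s) (I t) <= 3 * 2 ^- n).
Proof.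
move=> md [_ [M hM]].
have ex m : exists y, runs M m y /\ exists r, code_val y r /\
    `|d (I (sdec (cfst m))) (I (sdec (cfst (csnd m)))) - r| <= 2 ^- (csnd (csnd m)).
  have [y [r [h1 h2]]] := hM (sdec (cfst m)) (sdec (cfst (csnd m))) (csnd (csnd m)).
  exists y; split; last by exists r.
  by move: h1; rewrite !sdecK /cfst /csnd !unpairK.
(* The hypothesis only asserts that outputs exist; choosing them makes a total function, computable
   because [M] produces its values. *)
pose D m := proj1_sig (constructive_indefinite_description _ (ex m)).
have DP m : runs M m (D m) /\ exists r, code_val (D m) r /\
    `|d (I (sdec (cfst m))) (I (sdec (cfst (csnd m)))) - r| <= 2 ^- (csnd (csnd m)).
  by rewrite /D; case: constructive_indefinite_description.
have hD : computable D by apply: (runs_computable M) => m; have [] := DP m.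
pose v p := csnd (D (cpair (cfst p) (cpair (csnd p) n))).
have hv : computable v.
  apply: computable_csnd; apply: computable_comp hD _.
  apply: computable_pair computable_fst _.
  exact: computable_pair computable_snd (computable_const n).
exists (fun p => 2 ^ n * cfst (v p) - 2 ^ 1 * (csnd (v p)).+1)%N.
  apply: computable_subn; apply: computable_mul_exp2; first exact: computable_cfst.
  by apply: computable_comp computable_succ _; apply: computable_csnd.
move=> s t; rewrite /v cfst_pair csnd_pair.
have [_ [r [[a [b [c [-> ->]]]]]]] := DP (cpair (scode s) (cpair (scode t) n)).
rewrite !(cfst_pair, csnd_pair) !scodeK.
set dd := d _ _; have dd0 : 0 <= dd by exact: metric_ge0.
set eta : RR := 2 ^- n => h.
have {}h : `|dd - b%:R / c.+1%:R| <= eta.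
  (* The reverse triangle inequality replaces the approximation by its absolute value. *)
  apply: le_trans h; have := ler_dist_dist dd ((-1) ^+ a * (b%:R / c.+1%:R)).
  have r0 : 0 <= b%:R / c.+1%:R :> RR by rewrite divr_ge0.
  by rewrite normrM normrX normrN1 expr1n mul1r (ger0_norm dd0) (ger0_norm r0).
have testE : ((2 ^ n * b - 2 ^ 1 * c.+1)%N = 0%N) <-> (b%:R / c.+1%:R <= 2 * eta).
  rewrite ler_pdivrMr ?ltr0n // /eta -mulrA [_^-1 * _]mulrC mulrA ler_pdivlMr ?exprn_gt0 ?ltr0n //.
  rewrite -natrX -!natrM ler_nat mulnC expn1 -subn_eq0; split=> [->|/eqP] //.
move: h; rewrite ler_norml => /andP[h1 h2]; split=> [le|/testE].
  by apply/testE; move: h1; set q := _ / _; lra.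
by move: h1 h2; set q := _ / _; lra.
Qed.

(** Neither [J] nor the choice of [sel] need be computable: only finitely many of their data enter,
    through the table [tab] built into the machine. *)
Lemma translate_interpretation X (d : X -> X -> RR) I J (e : RR) :
  compact_metric d -> computable_interpretation d I -> interpretation d J -> 0 < e ->
  exists g delta, [/\ computable g, 0 < delta &
    forall s y, d (I s) y < delta -> d (J (sdec (g (scode s)))) y < e].
Proof.
move=> cpt hI hJ e0; have [md _] := cpt; have [_ [sym tri]] := md.
(* The final error is below [eta / 2 + 3 * eta + eta]: from [J t] to [I (sel t)], then to [I s] by
   the test, then to [y]. This is less than [8 * eta], hence than [e]. *)
have [n hn] := exp2V_small (e / 8) ltac:(lra).
set eta : RR := 2 ^- n in hn; have eta0 : 0 < eta by rewrite invr_gt0 exprn_gt0 ?ltr0n.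
have [l hl] := compact_net X d J (eta / 2) cpt hJ ltac:(lra).
have [test ht testP] := computable_near X d I n md hI.
have approx t : exists s, d (I s) (J t) < eta / 2 by apply: (hI.1); lra.
pose sel t := proj1_sig (constructive_indefinite_description _ (approx t)).
have selP t : d (I (sel t)) (J t) < eta / 2.
  by rewrite /sel; case: constructive_indefinite_description.
pose tab := [seq (scode (sel t), scode t) | t <- l].
exists (select test tab), eta; split=> [||s y hy]; [exact: computable_select|exact: eta0|].
have [] := selectP test tab (scode s).
  (* Some entry passes: a net point [J t] is within [eta / 2] of both [I s] and [I (sel t)]. *)
  have [t tl h] := hl (I s); exists (scode (sel t), scode t) => /=.
    by apply/mapP; exists t.
  apply: (testP s (sel t)).1; rewrite -/eta.
  by have := tri (I s) (J t) (I (sel t)); have := selP t;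
    rewrite (sym (I s) (J t)) (sym (J t) (I (sel t))); lra.
move=> [_ _] /mapP[t tl [-> ->]] /= [/(testP s (sel t)).2 h ->]; rewrite -/eta in h.
rewrite scodeK; have := selP t; have := tri (J t) (I s) y.
have := tri (J t) (I (sel t)) (I s).
rewrite (sym (J t) (I (sel t))) (sym (I (sel t)) (I s)); lra.
Qed.

(** * Complexity of finite orbits *)

Section Complexity.

Variables (X : Type) (d : X -> X -> RR) (T : X -> X).
Variables (U : seq bool -> option (seq bool)) (Q : seq bool -> seq (seq bool)).
Hypothesis univ : universal_machine U.
Hypothesis recQ : total_recursive_surjection Q.

(** Essential here is the uniformity: [delta] and [c] are fixed before [x], [n] and the program. *)
Lemma Eset_translate I J (e : RR) : compact_metric d ->
  computable_interpretation d I -> interpretation d J -> 0 < e ->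
  exists (delta : RR) (c : nat), 0 < delta /\ forall x n k,
    Eset d T U Q I x n delta k -> Eset d T U Q J x n e (c + k)%N.
Proof.
move=> cpt hI hJ e0.
have [g [delta [hg delta0 gP]]] := translate_interpretation X d I J e cpt hI hJ e0.
have [c hc] := universal_transducer U Q g univ recQ hg.
exists delta, c; split=> // x n k [p [o [Up [<- [sz h]]]]].
have [p' [o' [Up' sp' Qo']]] := hc p o Up.
exists p', o'; split=> //; split=> //; rewrite Qo' size_map; split=> // i le.
by rewrite (nth_map [::]) ?sz ?ltnS //; apply: gP; apply: h.
Qed.

(** On an empty set [natmin] would be an arbitrary number; this makes [Ecomp] a true minimum. *)
Lemma Eset_nonempty I x n (e : RR) : interpretation d I -> 0 < e ->
  exists k, Eset d T U Q I x n e k.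
Proof.
move=> hI e0; have approx i := hI (iter i T x) e e0.
pose f i := proj1_sig (constructive_indefinite_description _ (approx i)).
have [o Qo] := recQ.2 (mkseq f n.+1); have [p Up] := universal_total U o univ.
exists (size p), p, o; rewrite Qo size_mkseq; do 3!split=> //; move=> i le.
by rewrite nth_mkseq ?ltnS // /f; case: constructive_indefinite_description.
Qed.

Lemma natminP (P : nat -> Prop) : (exists k, P k) ->
  P (natmin P) /\ forall j, P j -> (natmin P <= j)%N.
Proof.
move=> [k0 P0]; apply: (epsilon_spec (inhabits 0%N) (fun k => P k /\ forall j, P j -> (k <= j)%N)).
elim/ltn_ind: k0 P0 => k IH Pk.
have [[j [Pj jk]]|no] := classic (exists j, P j /\ (j < k)%N); first exact: IH jk Pj.
by exists k; split=> // j Pj; rewrite leqNgt; apply/negP => jk; apply: no; exists j.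
Qed.

Lemma EcompP I x n (e : RR) : interpretation d I -> 0 < e ->
  Eset d T U Q I x n e (Ecomp d T U Q I x n e) /\
  forall k, Eset d T U Q I x n e k -> (Ecomp d T U Q I x n e <= k)%N.
Proof. by move=> hI e0; apply: natminP; apply: Eset_nonempty. Qed.

Lemma Ecomp_antitone I x n (e e' : RR) : interpretation d I -> 0 < e -> e <= e' ->
  (Ecomp d T U Q I x n e' <= Ecomp d T U Q I x n e)%N.
Proof.
move=> hI e0 ee'; apply: (EcompP I x n e' hI (lt_le_trans e0 ee')).2.
have [p [o [Up [sp [sz h]]]]] := (EcompP I x n e hI e0).1.
exists p, o; do 3!split=> //; move=> i /h; move/lt_le_trans; exact.
Qed.

(** Finiteness of the set of short strings, in the form of a bound; the induction splits off the
    first letter. *)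
Lemma short_strings_bounded (f : seq bool -> nat) K :
  exists N, forall p, (size p <= K)%N -> (f p <= N)%N.
Proof.
elim: K f => [|K IH] f; first by exists (f [::]) => -[].
have [N0 h0] := IH (fun p => f (false :: p)); have [N1 h1] := IH (fun p => f (true :: p)).
exists (maxn (f [::]) (maxn N0 N1)) => -[|[] p] /= le; rewrite !leq_max ?leqnn //.
  by rewrite h1 ?orbT.
by rewrite h0 ?orbT.
Qed.

(* Finitely many programs are shorter than [K], and each outputs a list of one length only. *)
Lemma Ecomp_unbounded I x (e : RR) K : interpretation d I -> 0 < e ->
  exists N, forall n, (N <= n)%N -> (K <= Ecomp d T U Q I x n e)%N.
Proof.
move=> hI e0.
have [N hN] := short_strings_bounded (fun p => if U p is Some o then size (Q o) else 0%N) K.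
exists N => n le; rewrite leqNgt; apply/negP => lt.
have [p [o [Up [sp [sz _]]]]] := (EcompP I x n e hI e0).1.
by have := hN p; rewrite sp Up sz => /(_ (ltnW lt)); lia.
Qed.

End Complexity.

(** * Classes of hyperreals *)

Section Hyperreals.

Variables (F : realFieldType) (iota : {rmorphism RR -> F}).

Lemma hbounded_mul z w : hbounded iota z -> hbounded iota w -> hbounded iota (z * w).
Proof.
move=> [r hr] [s hs]; exists (r * s); rewrite normrM rmorphM.
by apply: ler_pM.
Qed.

Lemma hbounded_le1 z : `|z| <= 1 -> hbounded iota z.
Proof. by exists 1; rewrite rmorph1. Qed.

Lemma hbounded_ratio_le (a b : F) : 0 < a -> 0 < b -> a <= b -> hbounded iota (a / b).
Proof.
move=> a0 b0 ab; apply: hbounded_le1.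
by rewrite gtr0_norm ?divr_gt0 // ler_pdivrMr // mul1r.
Qed.

Lemma hbounded_trans (a b c : F) : 0 < b ->
  hbounded iota (a / b) -> hbounded iota (b / c) -> hbounded iota (a / c).
Proof.
move=> b0 h1 h2; have := hbounded_mul _ _ h1 h2.
by rewrite mulrA divfK // gt_eqF.
Qed.

(** Bounded ratios compose, so a comparison over all representatives reduces to one ratio. *)
Lemma cleP (a b : F) : 0 < a -> 0 < b -> cle iota a b <-> hbounded iota (a / b).
Proof.
move=> a0 b0; split.
  have refl z : 0 < z -> simeq iota z z by split; apply: hbounded_ratio_le.
  case/(_ a b a0 b0 (refl a a0) (refl b b0)) => [[]//|lt].
  exact/hbounded_ratio_le/ltW.
move=> ab x y x0 y0 [xa _] [_ bY].
have xy : hbounded iota (x / y).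
  exact: hbounded_trans b0 (hbounded_trans _ _ _ a0 xa ab) bY.
have [lt|le] := ltP x y; [by right|left; split=> //].
exact: hbounded_ratio_le.
Qed.

Lemma cltP (a b : F) : 0 < a -> 0 < b ->
  clt iota a b <-> hbounded iota (a / b) /\ ~ hbounded iota (b / a).
Proof.
move=> a0 b0; rewrite /clt cleP // /simeq; tauto.
Qed.

Lemma clt_cle_trans (a b c : F) : 0 < a -> 0 < b -> 0 < c ->
  clt iota a b -> cle iota b c -> clt iota a c.
Proof.
move=> a0 b0 c0 /cltP [] // ab nba /cleP -/(_ b0 c0) bc; apply/cltP => //; split.
  exact: hbounded_trans b0 ab bc.
by move=> ca; apply: nba; apply: hbounded_trans c0 bc ca.
Qed.

(** Two opposite strict comparisons would contradict each other at an index beyond both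
    thresholds. *)
Lemma rleP u v : (forall n, 0 < u n) -> (forall n, 0 < v n) ->
  rle iota u v <-> ~ rlt iota v u.
Proof.
move=> u0 v0; split; last first.
  move=> nvu; have [uv|nuv] := classic (rlt iota u v); [by left|by right].
move=> [[M hM]|[]//] [N hN]; set k := (maxn M N).+1.
have Mk : (M < k)%N by rewrite ltnS leq_maxl.
have Nk : (N < k)%N by rewrite ltnS leq_maxr.
have /cltP [] // := hM k k Mk Mk.
by have /cltP [] // := hN k k Nk Nk.
Qed.

Lemma is_sup_eps_exists (c : RR -> F) : (forall e, 0 < e -> 0 < c e) ->
  (forall e e', 0 < e -> e <= e' -> c e' <= c e) -> exists s, is_sup_eps iota c s.
Proof.
move=> c0 anti; pose s n := c n.+1%:R^-1.
have pos n : 0 < n.+1%:R^-1 :> RR by rewrite invr_gt0 ltr0n.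
have s0 n : 0 < s n by apply: c0.
exists s; split; [|split].
- split=> //; left=> n m nm; apply/cleP => //; apply: hbounded_ratio_le => //.
  by apply: anti => //; rewrite lef_pV2 ?posrE ?ltr0n // ler_nat ltnS.
- move=> e e0; apply/rleP => // [_|[M hM]]; first exact: c0.
  (* Large enough to exceed [M] and to have [1 / (n + 1) <= e], whence [c e <= s n]. *)
  pose n := maxn M.+1 (Num.bound e^-1).
  have Mn : (M < n)%N by rewrite leq_maxl.
  have /cltP [||_ nb] // := hM n n Mn Mn; first exact: c0.
  apply: nb; apply: hbounded_ratio_le => //; first exact: c0.
  apply: anti => //; rewrite invf_ple ?posrE ?ltr0n // ltW //.
  have eV : 0 <= e^-1 by rewrite invr_ge0 ltW.
  apply: lt_le_trans (archi_boundP eV) _.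
  by rewrite ler_nat; apply: leqW; apply: leq_maxr.
- move=> u [u0 _] ub; apply/rleP => // -[M hM].
  (* If [u] were strictly below [s] from [M] on, it would be strictly below the constant [s M.+1],
     the value of [c] at [1 / (M + 2)]. *)
  have /rleP h := ub _ (pos M.+1); apply: h => [_|//|]; first exact: c0.
  by exists M => n m Mn _; apply: hM.
Qed.

End Hyperreals.

(** * Order properties of the homomorphism from sequences to hyperreals *)

Section HyperrealLift.

Variables (F : realFieldType) (iota : {rmorphism RR -> F}) (Jh : (nat -> RR) -> F).
Hypothesis hyp : hyperreals iota Jh.

Lemma Jh_add f g : Jh (fun n => f n + g n) = Jh f + Jh g.
Proof. by have [_ []] := hyp. Qed.

Lemma Jh_ge (a : RR) f k : (0 < k)%N ->
  (forall n, (0 < n)%N -> a <= f (k * n)%N) -> iota a <= Jh f.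
Proof. by move=> k0 h; have [_ [_ [_ [_ [_ H]]]]] := hyp; apply: H; exists k. Qed.

Lemma Jh_le f g k : (0 < k)%N ->
  (forall n, (0 < n)%N -> f (k * n)%N <= g (k * n)%N) -> Jh f <= Jh g.
Proof.
move=> k0 h; have -> : g = (fun n => f n + (g n - f n)).
  by apply: functional_extensionality => n; rewrite addrC subrK.
rewrite Jh_add lerDl -(rmorph0 iota); apply: (Jh_ge _ _ k) => // n n0.
by rewrite subr_ge0 h.
Qed.

End HyperrealLift.

Theorem theorem30 (X : Type) (d : X -> X -> RR) (T : X -> X)
  (U : seq bool -> option (seq bool)) (Q : seq bool -> seq (seq bool))
  (F : realFieldType) (iota : {rmorphism RR -> F}) (Jh : (nat -> RR) -> F)
  (I J : seq bool -> X) :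
  compact_metric d -> universal_machine U -> total_recursive_surjection Q ->
  hyperreals iota Jh ->
  computable_interpretation d I -> interpretation d J ->
  forall x : X,
    sup_ge iota (Eeps Jh d T U Q I x) (Eeps Jh d T U Q J x).
Proof.
move=> cpt univ recQ hyp hI hJ x.
have E_gt0 K : interpretation d K -> forall e : RR, 0 < e -> 0 < Eeps Jh d T U Q K x e.
  move=> hK e e0; have [N hN] := Ecomp_unbounded X d T U Q univ recQ K x e 1 hK e0.
  apply: lt_le_trans ltr01 _; rewrite -(rmorph1 iota).
  (* A bound valid from [N] on holds at all positive multiples of [N.+1], the form that the order
     axiom on [Jh] takes. *)
  apply: (Jh_ge F iota Jh hyp _ _ N.+1) => // n n0.
  by rewrite ler1n; apply: hN; apply: leq_trans (leqnSn N) (leq_pmulr _ n0).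
have E_anti K : interpretation d K -> forall e e' : RR, 0 < e -> e <= e' ->
    Eeps Jh d T U Q K x e' <= Eeps Jh d T U Q K x e.
  move=> hK e e' e0 ee'; apply: (Jh_le F iota Jh hyp _ _ 1) => // n _.
  by rewrite ler_nat; apply: Ecomp_antitone.
have hI' := hI.1.
split; [|split]; try by apply: is_sup_eps_exists; eauto.
(* Since [s'] is the least upper bound, it suffices that [s] bounds the class for [J] at each [e];
   otherwise [s] would fall strictly below the class for [I] at [delta]. *)
move=> s s' [[s0 ms] [ub _]] [_ [_ least]]; apply: (least s) => // e e0.
have [delta [c [delta0 tr]]] := Eset_translate X d T U Q univ recQ I J e cpt hI hJ e0.
have Ie := E_gt0 I hI' delta delta0; have Je := E_gt0 J hJ e e0.
apply/rleP => // -[M hM].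
have /rleP h : rle iota (fun _ => Eeps Jh d T U Q I x delta) s by exact: ub.
apply: h => //; exists M => n m Mn Mm.
apply: (clt_cle_trans _ _ _ _ _ (s0 n) Je Ie (hM n m Mn Mm)).
(* The ratio is at most 2: the complexity for [J] is at most [c] plus that for [I], and the latter
   is at least [c] from [N] on. *)
apply/cleP => //; exists 2.
rewrite gtr0_norm ?divr_gt0 // ler_pdivrMr // rmorph_nat mulr_natl mulr2n.
rewrite -(Jh_add F iota Jh hyp).
have [N hN] := Ecomp_unbounded X d T U Q univ recQ I x delta c hI' delta0.
apply: (Jh_le F iota Jh hyp _ _ N.+1) => // k k0.
set i := (N.+1 * k)%N; have Ni : (N <= i)%N.
  exact: leq_trans (leqnSn N) (leq_pmulr _ k0).
rewrite -natrD ler_nat.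
apply: (@leq_trans (c + Ecomp d T U Q I x i delta)); last by rewrite leq_add2r hN.
apply: (EcompP X d T U Q univ recQ J x i e hJ e0).2.
exact/tr/(EcompP X d T U Q univ recQ I x i delta hI' delta0).1.
Qed.
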